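(* Let $\mathcal{H}$ be an infinite dimensional complex Hilbert space, let $m\ge 1$ be an integer, let $P\in B(\mathcal{H})$ be a positive invertible operator, and let $T\in B(\mathcal{H})$ be an $(m,P)$-expansive operator. Then the following conditions are pairwise equivalent: (i) $T$ is power bounded. (ii) $T$ is (a $C_{1\cdot}$-operator which is) similar to an isometry. (iii) There exists a positive invertible operator $Q\in B(\mathcal{H})$ such that $T$ is $(n,Q)$-isometric for all integers $n\geq 1$. (iv) There exist a positive invertible operator $Q\in B(\mathcal{H})$ and an equivalent norm $\|\cdot\|_Q$ on $\mathcal{H}$, induced by the inner product $\langle x,y\rangle_Q=\langle Qx,y\rangle$, such that $T$ is $n$-isometric in this new norm for all integers $n\geq 1$, i.e. $\sum_{j=0}^n(-1)^j\binom{n}{j}\|T^jx\|_Q^2=0$ for all $x\in\mathcal{H}$ and all integers $n\ge 1$.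
   Context: $B(\mathcal{H})$ is the algebra of bounded linear operators on $\mathcal{H}$. For $T,P\in B(\mathcal{H})$ and an integer $m\ge 1$ put $\triangle_{T^*,T}^m(P)=\sum_{j=0}^m(-1)^j\binom{m}{j}{T^*}^jPT^j$. $T$ is $(m,P)$-expansive if $\triangle_{T^*,T}^m(P)\le 0$, and $(m,P)$-isometric if $\triangle_{T^*,T}^m(P)=0$. $T$ is power bounded if there is $M>0$ with $\sup_{n}\|T^n\|\le M$. $T$ is a $C_{1\cdot}$-operator if $\inf_{n\in\mathbb{N}}\|T^nx\|>0$ for every $0\ne x\in\mathcal{H}$. $T$ is similar to an isometry if $T=S^{-1}VS$ for some invertible $S\in B(\mathcal{H})$ and some isometry $V\in B(\mathcal{H})$. *)

(* Defs.v *)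
From HB Require Import structures.
From mathcomp Require Import all_boot all_order all_algebra ring lra.
From mathcomp Require Import mathcomp_extra boolp classical_sets.
From mathcomp Require Import reals ereal topology normedtype sequences.
From mathcomp.real_closed Require Import complex.

Set Implicit Arguments.
Unset Strict Implicit.
Unset Printing Implicit Defensive.

Import Order.TTheory GRing.Theory Num.Theory.
Import numFieldNormedType.Exports.

Local Open Scope classical_set_scope.
Local Open Scope ring_scope.
Local Notation "x %:C" := (real_complex _ x) (format "x %:C").

HB.mixin Record CompleteNormedModule_isHilbert (R : realType) (H : Type)
    of CompleteNormedModule R[i] H := {
  inner : {dot H for Num.conj};
  normr_inner : forall x : H, `|x| ^+ 2 = inner x x
}.

#[short(type="hilbertType")]
HB.structure Definition Hilbert (R : realType) :=
  {H of CompleteNormedModule_isHilbert R H & CompleteNormedModule R[i] H}.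

Definition finite_dimensional (K : pzRingType) (V : lmodType K) : Prop :=
  exists n (e : 'I_n -> V), forall x, exists c : 'I_n -> K,
    x = \sum_(i < n) c i *: e i.

(* The norm of a normed module over R[i] takes its values in R[i]. *)
Definition hnorm (R : realType) (H : normedModType R[i]) (x : H) : R :=
  complex.Re `|x|.

Definition bounded_op (R : realType) (H : normedModType R[i]) (f : H -> H) :=
  exists M : R[i], forall x, `|f x| <= M * `|x|.

Record bop (R : realType) (H : normedModType R[i]) := Bop {
  bop_fun :> H -> H;
  bop_linear : linear bop_fun;
  bop_bounded : bounded_op bop_fun
}.

Section BopTheory.
Variables (R : realType) (H : normedModType R[i]).
Implicit Types S T U : bop H.

HB.instance Definition _ T :=
  GRing.isLinear.Build R[i] H H *:%R (T : H -> H) (bop_linear T).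

HB.instance Definition _ := gen_eqMixin (bop H).
HB.instance Definition _ := gen_choiceMixin (bop H).

Lemma bopP S T : (forall x, S x = T x) -> S = T.
Proof.
case: S T => [s sl sb] [t tl tb] /= /funext st.
by case: _ / st tl tb => tl tb; congr Bop; exact: Prop_irrelevance.
Qed.

Lemma bop_bound T : exists2 M : R[i], 0 <= M & forall x, `|T x| <= M * `|x|.
Proof.
have [M TM] := bop_bounded T.
have [[x x0]|/forallNP H0] := pselect (exists x : H, x != 0).
  have nx : 0 < `|x| by rewrite normr_gt0.
  exists M => //.
  by rewrite -(pmulr_lge0 _ nx); apply: le_trans (TM x).
exists 0 => // x; have /negP/negPn/eqP -> := H0 x.
by rewrite linear0 normr0 mul0r.
Qed.

Lemma zero_bop_bounded :
  bounded_op (fun _ => 0 : H).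
Proof. by exists 0 => x; rewrite normr0 mul0r. Qed.
Lemma zero_bop_linear : linear (fun _ : H => 0 : H).
Proof. by move=> a x y; rewrite scaler0 addr0. Qed.
Definition zero_bop := Bop zero_bop_linear zero_bop_bounded.

Lemma one_bop_bounded : bounded_op (@idfun H).
Proof. by exists 1 => x; rewrite mul1r. Qed.
Lemma one_bop_linear : linear (@idfun H).
Proof. by []. Qed.
Definition one_bop := Bop one_bop_linear one_bop_bounded.

Lemma opp_bop_bounded T :
  bounded_op (fun x => - T x).
Proof. by have [M TM] := bop_bounded T; exists M => x; rewrite normrN. Qed.
Lemma opp_bop_linear T : linear (fun x => - T x).
Proof. by move=> a x y; rewrite linearP opprD scalerN. Qed.
Definition opp_bop T := Bop (opp_bop_linear T) (opp_bop_bounded T).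

Lemma add_bop_bounded S T :
  bounded_op (fun x => S x + T x).
Proof.
have [M SM] := bop_bounded S; have [N TN] := bop_bounded T.
exists (M + N) => x; apply: le_trans (ler_normD _ _) _.
by rewrite mulrDl lerD.
Qed.
Lemma add_bop_linear S T : linear (fun x => S x + T x).
Proof. by move=> a x y; rewrite !linearP scalerDr addrACA. Qed.
Definition add_bop S T := Bop (add_bop_linear S T) (add_bop_bounded S T).

Lemma mul_bop_bounded S T :
  bounded_op (fun x => S (T x)).
Proof.
have [M M0 SM] := bop_bound S; have [N TN] := bop_bounded T.
exists (M * N) => x; apply: le_trans (SM _) _.
by rewrite -mulrA ler_wpM2l.
Qed.
Lemma mul_bop_linear S T : linear (fun x => S (T x)).
Proof. by move=> a x y; rewrite !linearP. Qed.
Definition mul_bop S T := Bop (mul_bop_linear S T) (mul_bop_bounded S T).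

Lemma add_bopA : associative add_bop.
Proof. by move=> S T U; apply: bopP => x /=; rewrite addrA. Qed.
Lemma add_bopC : commutative add_bop.
Proof. by move=> S T; apply: bopP => x /=; rewrite addrC. Qed.
Lemma add_0bop : left_id zero_bop add_bop.
Proof. by move=> T; apply: bopP => x /=; rewrite add0r. Qed.
Lemma add_Nbop : left_inverse zero_bop opp_bop add_bop.
Proof. by move=> T; apply: bopP => x /=; rewrite addNr. Qed.

HB.instance Definition _ :=
  GRing.isZmodule.Build (bop H) add_bopA add_bopC add_0bop add_Nbop.

Lemma mul_bopA : associative mul_bop.
Proof. by move=> S T U; apply: bopP. Qed.
Lemma mul_1bop : left_id one_bop mul_bop.
Proof. by move=> T; apply: bopP. Qed.
Lemma mul_bop1 : right_id one_bop mul_bop.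
Proof. by move=> T; apply: bopP. Qed.
Lemma mul_bopDl : left_distributive mul_bop +%R.
Proof. by move=> S T U; apply: bopP. Qed.
Lemma mul_bopDr : right_distributive mul_bop +%R.
Proof. by move=> S T U; apply: bopP => x /=; rewrite linearD. Qed.

(* A pzRingType because bop H is the zero ring when H = 0. *)
HB.instance Definition _ := GRing.Zmodule_isPzRing.Build (bop H)
  mul_bopA mul_1bop mul_bop1 mul_bopDl mul_bopDr.

Definition invertible T := exists S, T * S = 1 /\ S * T = 1.

Definition opnorm T : R := sup [set hnorm (T x) | x in [set x | hnorm x <= 1]].

Definition power_bounded T := exists2 M : R, 0 < M &
  (ereal_sup (range (fun n => (opnorm (T ^+ n))%:E)) <= M%:E)%E.

Definition C1dot T :=
  forall x, x != 0 -> 0 < inf (range (fun n => hnorm ((T ^+ n) x))).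

Definition isometric T := forall x, `|T x| = `|x|.

Definition similar_to_isometry T := exists S Sinv V,
  [/\ S * Sinv = 1, Sinv * S = 1, isometric V & T = Sinv * V * S].

End BopTheory.

Section HilbertTheory.
Variables (R : realType) (H : hilbertType R).
Implicit Types x y z : H.

Lemma hnormE x : `|x| = (hnorm x)%:C.
Proof. by rewrite /hnorm RRe_real// ger0_real. Qed.

Lemma hnorm_ge0 x : 0 <= hnorm x.
Proof. by rewrite -(@ler0c R) -hnormE. Qed.

Lemma innerC x y : inner x y = (inner y x)^*.
Proof. by rewrite hermC expr0 mul1r. Qed.

Lemma hnormX x : (hnorm x ^+ 2)%:C = inner x x.
Proof. by rewrite rmorphXn /= -hnormE normr_inner. Qed.

Lemma hnorm_parallelogram x y :
  hnorm (x - y) ^+ 2 = 2 * hnorm x ^+ 2 + 2 * hnorm y ^+ 2 - hnorm (x + y) ^+ 2.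
Proof.
have E (a : R) : (2 * a)%:C = 2 * a%:C by rewrite rmorphM /= rmorph_nat.
apply: (@complexI R); rewrite rmorphB rmorphD /= !E !hnormX.
rewrite hnormB hnormD /= expr0 mul1r.
set u := inner x x; set v := inner y y; set w := (_ + _^* : R[i])%R.
ring.
Qed.

Lemma hnorm_distC x y : hnorm (x - y) = hnorm (y - x).
Proof. by rewrite /hnorm distrC. Qed.

Lemma hnorm_triangle x y : hnorm (x + y) <= hnorm x + hnorm y.
Proof. by rewrite -(@lecR R) rmorphD /= -!hnormE ler_normD. Qed.

Lemma hnormZ_ge0 (a : R) x : 0 <= a -> hnorm (a%:C *: x) = a * hnorm x.
Proof.
move=> a0; apply: (@complexI R).
by rewrite rmorphM /= -!hnormE normrZ ger0_norm ?ler0c.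
Qed.

Lemma min_orthogonal (u h : H) :
  (forall t : R[i], hnorm u <= hnorm (u + t *: h)) -> inner u h = 0.
Proof.
move=> umin; apply/eqP/negPn/negP => w0.
set w := inner u h in w0; set k := inner h h.
have k0 : 0 <= k by rewrite /k -normr_inner exprn_ge0.
have kr : k^* = k by apply/CrealP; rewrite ger0_real.
have W0 : 0 < w * w^* by rewrite mul_conjC_gt0.
have k1 : 0 < k + 1 by rewrite ltr_wpDl.
have k1' : k + 1 != 0 by rewrite gt_eqF.
pose s := (k + 1)^-1.
have s0 : 0 < s by rewrite invr_gt0.
have sr : s^* = s by apply/CrealP; rewrite gtr0_real.
have := umin (- (s * w)).
rewrite -(@ler_pXn2r _ 2) ?nnegrE ?hnorm_ge0// -(@lecR R) !hnormX.
rewrite hnormD expr0 mul1r !linearZr /= linearZl /=.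
rewrite -[inner u h]/w -/k !(rmorphM, rmorphN) /= sr conjCK.
rewrite sr; set u2 := inner u u.
have -> : u2 + - (s * w^*) * (- (s * w) * k)
            + (- (s * w^*) * w + - (s * w) * w^*)
        = u2 - s * (w * w^*) * (s * (k + 2)).
  move: (w^*) => w'; rewrite /s; field; exact: k1'.
rewrite lerBrDr gerDl => /le_gtF.
have k2 : 0 < k + 2 by rewrite ltr_wpDl.
by rewrite (mulr_gt0 (mulr_gt0 s0 W0) (mulr_gt0 s0 k2)).
Qed.

Lemma riesz (g : H -> R[i]) (M : R[i]) :
  (forall a x y, g (a *: x + y) = a * g x + g y) ->
  (forall x, `|g x| <= M * `|x|) -> exists z, forall x, g x = inner x z.
Proof.
move=> gl gM.
have g0 : g 0 = 0.
  by apply/eqP; rewrite -normr_le0; apply: le_trans (gM _) _; rewrite normr0 mulr0.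
have gZ a x : g (a *: x) = a * g x by rewrite -[a *: x]addr0 gl g0 addr0.
have gD x y : g (x + y) = g x + g y by rewrite -[x]scale1r gl mul1r scale1r.
have gB x y : g (x - y) = g x - g y by rewrite gD -scaleN1r gZ mulN1r.
have [[x1 gx1]|/forallNP gx0] := pselect (exists x, g x != 0); last first.
  by exists 0 => x; have /negP/negPn/eqP -> := gx0 x; rewrite linear0r.
pose A := [set hnorm x | x in [set x | g x = 1]].
have A0 : A !=set0.
  by exists (hnorm ((g x1)^-1 *: x1)), ((g x1)^-1 *: x1); rewrite //= gZ mulVf.
have Alb : lbound A 0 by move=> _ [x _ <-]; exact: hnorm_ge0.
have Ainf : has_inf A by split => //; exists 0.
set d := inf A.
have d0 : 0 <= d by exact: lb_le_inf.
have dle x : g x = 1 -> d <= hnorm x.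
  by move=> gx; apply: ge_inf; [exists 0|exists x].
have /choice [u uP] (n : nat) : exists x, g x = 1 /\ hnorm x < d + n.+1%:R^-1.
  have [|_ [x gx <-] xd] := @inf_adherent _ A n.+1%:R^-1 _ Ainf.
    by rewrite invr_gt0.
  by exists x.
have dist N n : (N <= n)%N ->
    hnorm (u N - u n) ^+ 2 <= (8 * d + 4) * N.+1%:R^-1.
  move=> Nn; have [gN uN] := uP N; have [gn un] := uP n.
  have h2 : 2 * d <= hnorm (u N + u n).
    have : d <= hnorm ((2^-1)%:C *: (u N + u n)).
      by apply: dle; rewrite gZ gD gN gn fmorphV rmorph_nat mulVf// pnatr_eq0.
    rewrite hnormZ_ge0 ?invr_ge0// => dh.
    by rewrite -ler_pdivlMl.
  have nN : n.+1%:R^-1 <= N.+1%:R^-1 :> R by rewrite lef_pV2 ?posrE// ler_nat.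
  have e0 : 0 < N.+1%:R^-1 :> R by rewrite invr_gt0.
  have e1 : N.+1%:R^-1 <= 1 :> R by rewrite invf_le1// ler1n.
  have := hnorm_ge0 (u N); have := hnorm_ge0 (u n).
  rewrite hnorm_parallelogram; move: e0 e1 nN uN un h2.
  move: (hnorm _) (hnorm _) (hnorm _) (_^-1) (_^-1) => a b c e f *.
  nra.
have [l ul] : exists l : H, u @ \oo --> l.
  suff : cvg (u @ \oo) by exists (lim (u @ \oo)).
  apply: cauchy_cvg; apply: (@cauchy_exP R[i] H) => e e0.
  have [r r0 er] : exists2 r : R, 0 < r & e = r%:C.
    exists (complex.Re e); last by rewrite RRe_real// gtr0_real.
    by rewrite -(@ltcR R 0) RRe_real// gtr0_real.
  pose N := Num.truncn ((8 * d + 4) / r ^+ 2).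
  exists (u N); exists N => // n /= Nn.
  rewrite -ball_normE /= er hnormE ltcR.
  rewrite -(@ltr_pXn2r _ 2) ?nnegrE ?hnorm_ge0 ?(ltW r0)//.
  apply: le_lt_trans (dist _ _ Nn) _.
  rewrite ltr_pdivrMr// [ltRHS]mulrC -ltr_pdivrMr ?exprn_gt0//.
  exact: truncnS_gt.
have near_l (e : R) : 0 < e -> exists n, hnorm (l - u n) < e /\ n.+1%:R^-1 < e.
  move=> e0.
  have : \forall n \near \oo, `|l - u n| < e%:C.
    by move/cvgrPdist_lt : ul; apply; rewrite (@ltcR R 0 e).
  move=> [N _ NP]; pose m := Num.truncn e^-1.
  exists (maxn N m); split.
    by rewrite -(@ltcR R) -hnormE; apply: NP; rewrite /= leq_maxl.
  apply: (@le_lt_trans _ _ m.+1%:R^-1).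
    by rewrite lef_pV2 ?posrE// ler_nat ltnS leq_maxr.
  by rewrite invf_plt ?posrE// truncnS_gt.
have gl1 : g l = 1.
  apply/eqP; rewrite -subr_eq0 -normr_le0.
  have [M1 M10 MM1] : exists2 M1 : R, 0 < M1 & forall x, `|g x| <= (M1 * hnorm x)%:C.
    have Mx : 0 < M * `|x1| by apply: lt_le_trans (gM _); rewrite normr_gt0.
    have Mr : M \is Num.real.
      have [x10|x10] := eqVneq `|x1| 0; first by rewrite x10 mulr0 ltxx in Mx.
      by rewrite gtr0_real// -(pmulr_lgt0 _ (_ : 0 < `|x1|))// lt_def x10 normr_ge0.
    exists (`|complex.Re M| + 1) => [|x]; first by rewrite ltr_wpDl.
    apply: le_trans (gM x) _.
    rewrite rmorphM /= hnormE ler_wpM2r// ?ler0c ?hnorm_ge0//.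
    by rewrite -[M]RRe_real// lecR -[leLHS]addr0 lerD// ler_norm.
  rewrite real_leNgt ?real0 ?normr_real//.
  apply/negP => gl0; pose r := complex.Re `|g l - 1|.
  have rE : `|g l - 1| = r%:C by rewrite /r RRe_real// normr_real.
  have r0 : 0 < r by rewrite -(@ltcR R 0) -rE.
  have [n [ln _]] := near_l (r / M1) (divr_gt0 r0 M10).
  have := MM1 (l - u n); rewrite gB (uP n).1 rE lecR leNgt => /negP; apply.
  by rewrite mulrC -ltr_pdivlMr.
have ld : hnorm l <= d.
  apply/ler_addgt0Pr => e e0.
  have [n [ln ne]] := near_l (e / 2) (divr_gt0 e0 (ltr0n _ 2)).
  have := hnorm_triangle (l - u n) (u n); rewrite subrK => /le_trans; apply.
  move: (uP n).2 ln ne; move: (hnorm _) (hnorm _) (_^-1) => a b c *; lra.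
have orth h : g h = 0 -> inner h l = 0.
  move=> gh; rewrite innerC min_orthogonal ?rmorph0// => t.
  by apply: le_trans ld _; apply: dle; rewrite gD gZ gh mulr0 addr0.
have l0 : inner l l != 0.
  apply: contra_eqN gl1 => ll0; suff -> : l = 0 by rewrite g0 eq_sym oner_eq0.
  apply/eqP; rewrite -normr_eq0 -sqrf_eq0 normr_inner//.
have lr : (inner l l)^* = inner l l by rewrite -innerC.
exists ((inner l l)^-1 *: l) => x.
have : inner (x - g x *: l) l = 0.
  by apply: orth; rewrite gB gZ gl1 mulr1 subrr.
rewrite linearBl linearZl linearZr /= => /eqP; rewrite subr_eq0 => /eqP ->.
by rewrite fmorphV /= lr mulrCA mulVf// mulr1.
Qed.

Lemma inner_ext x y : (forall z, inner z x = inner z y) -> x = y.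
Proof.
move=> xy; apply/eqP; rewrite -subr_eq0 -normr_eq0 -sqrf_eq0 normr_inner.
by rewrite linearBr /= xy subrr.
Qed.

Lemma cauchy_schwarz x y : `|inner x y| <= `|x| * `|y|.
Proof.
have [->|y0] := eqVneq y 0; first by rewrite linear0r !normr0 mulr0.
rewrite -(@ler_pXn2r _ 2) ?nnegrE ?mulr_ge0// exprMn !normr_inner normCK.
set k := inner y y; set w := inner x y.
have k0 : 0 < k by rewrite /k -normr_inner exprn_gt0// normr_gt0.
have kr : k^* = k by apply/CrealP; rewrite gtr0_real.
have : 0 <= inner (k *: x - w *: y) (k *: x - w *: y).
  by rewrite -normr_inner exprn_ge0.
rewrite hnormB expr0 mul1r !linearZr /= !linearZl /=.
rewrite -[inner x y]/w -/k kr !(rmorphM) /= conjCK kr.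
set u := inner x x.
have -> : k * (k * u) + w^* * (w * k) - (w^* * (k * w) + w * (k * w^*))
        = k * (u * k - w * w^*) by move: (w^*) => w'; ring.
by rewrite pmulr_rge0// subr_ge0.
Qed.

Lemma adjoint_exists (T : bop H) :
  exists S : bop H, forall x y, inner (T x) y = inner x (S y).
Proof.
have [M M0 TM] := bop_bound T.
have /choice[S TS] y : exists z, forall x, inner (T x) y = inner x z.
  apply: (@riesz (fun x => inner (T x) y) (M * `|y|)) => [a x x'|x].
    by rewrite linearP linearDl linearZl.
  apply: le_trans (cauchy_schwarz _ _) _.
  by rewrite mulrAC ler_wpM2r.
have Sl : linear S.
  move=> a x y; apply: inner_ext => z.
  by rewrite -TS !linearDr !linearZr /= !TS.
have Sb : bounded_op S.
  exists M => y; have [->|Sy0] := eqVneq (S y) 0; first by rewrite normr0 mulr_ge0.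
  have Sy : 0 < `|S y| by rewrite normr_gt0.
  have := cauchy_schwarz (T (S y)) y.
  rewrite TS -normr_inner ger0_norm ?exprn_ge0// expr2 => /le_trans STy.
  rewrite -(ler_pM2l Sy); apply: STy.
  by rewrite mulrA ler_wpM2r// mulrC.
by exists (Bop Sl Sb) => x y; rewrite TS.
Qed.

Definition adjoint (T : bop H) : bop H := sval (cid (adjoint_exists T)).

Lemma adjointP (T : bop H) x y : inner (T x) y = inner x (adjoint T y).
Proof. exact: svalP (cid (adjoint_exists T)) x y. Qed.

(* Over the complex scalars this forces T to be self-adjoint. *)
Definition positive (T : bop H) := forall x, 0 <= inner (T x) x.

Definition bop_le (S T : bop H) := positive (T - S).

Definition defect (m : nat) (T P : bop H) : bop H :=
  \sum_(j < m.+1) ((-1) ^+ j * (adjoint T ^+ j * P * T ^+ j)) *+ 'C(m, j).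

Definition expansive (m : nat) (P T : bop H) := bop_le (defect m T P) 0.

Definition op_isometric (m : nat) (P T : bop H) := defect m T P = 0.

Definition induced_norm (B : {dot H for Num.conj}) (x : H) : R :=
  Num.sqrt (complex.Re (B x x)).

Definition is_norm (N : H -> R) :=
  [/\ forall x, N x = 0 -> x = 0,
      forall (a : R[i]) x, N (a *: x) = complex.Re `|a| * N x
    & forall x y, N (x + y) <= N x + N y].

Definition equivalent_norm (N : H -> R) := exists c C : R,
  [/\ 0 < c, 0 < C & forall x, c * hnorm x <= N x <= C * hnorm x].

Definition norm_isometric (n : nat) (N : H -> R) (T : bop H) := forall x,
  \sum_(j < n.+1) (-1) ^+ j * 'C(n, j)%:R * N ((T ^+ j) x) ^+ 2 = 0.

End HilbertTheory.

(* Main.v *)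
Require Import Defs.
From mathcomp Require Import all_boot all_order all_algebra.
From mathcomp Require Import boolp classical_sets reals.
From mathcomp.real_closed Require Import complex.
From HB Require Import structures.
From mathcomp Require Import mathcomp_extra ring lra.
From mathcomp Require Import ereal topology normedtype sequences.

Set Implicit Arguments.
Unset Strict Implicit.
Unset Printing Implicit Defensive.

Import Order.TTheory GRing.Theory Num.Theory.
Import numFieldNormedType.Exports.

Local Open Scope classical_set_scope.
Local Open Scope ring_scope.
Local Notation "x %:C" := (real_complex _ x) (format "x %:C").

(** All conditions are equivalent to the existence of a positive invertible
    [Q] with [T^* Q T = Q], that is, to [T] being an isometry for the inner
    product [<Q x, y>].

    Suppose that [T] is power bounded, fix [x] and put
    [a_n = <P T^n x, T^n x>].  The sequence [a] is bounded, and expansivity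
    applied at the vectors [T^n x] says that its [m]-th backward difference
    ([bdiff a n = a_n - a_(n+1)]) is nonpositive.  If the second difference of
    a bounded sequence [c] is nonpositive, then so is the first one: otherwise
    [c_n - c_(n+1)], which increases, stays above some [e > 0] and [c] is
    unbounded.  Hence [a] increases ([bounded_bdiff]).  So the positive
    operators [T^*^n P T^n] increase and are uniformly bounded, and they
    converge strongly to some [Q] ([monotone_strong_limit]).  It satisfies
    [T^* Q T = Q], and [Q >= P >= d > 0] makes it invertible
    ([power_bounded_expansive_invariant]).

    A positive invertible [Q] has a self-adjoint invertible square root [S]
    ([positive_square_root]).  It is obtained as follows.  After scaling,
    [Q = 1 - A] with [|A| <= r < 1], and the map [Y |-> (A + Y^2) / 2] is a
    contraction of the ball of radius [r]; its fixed point satisfies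
    [(1 - Y)^2 = 1 - A].  Completeness of the operators for the norm is only
    used through [bop_fixpoint], which also gives the Neumann series.

    When [T^* Q T = Q], the operator [S T S^-1] is an isometry and [|S T^n x|]
    does not depend on [n], so that [T] is [C_1.]; conversely [T = S^-1 V S]
    with [V] isometric gives [Q = S^* S].  Invariance of [Q] makes each defect
    equal to [(1 - 1)^n Q = 0].  The norm induced by [Q] is [|S x|], which is
    equivalent to the given norm, and the case [n = 1] of the last condition
    says that [T] preserves it, so that [T] is power bounded. *)

(** * The real part of the inner product *)

Section InnerProduct.
Variables (R : realType) (H : hilbertType R).
Implicit Types (x y z : H) (a : R).

(** The real inner product underlying the complex one; its values lie in [R],
    where estimates are simpler than in the partially ordered [R[i]]. *)
Definition rinner x y : R := complex.Re (inner x y).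

Lemma ReD (u v : R[i]) : complex.Re (u + v) = complex.Re u + complex.Re v.
Proof. by case: u v => [? ?] [? ?]. Qed.

Lemma ReN (u : R[i]) : complex.Re (- u) = - complex.Re u.
Proof. by case: u. Qed.

Lemma ReZ a (u : R[i]) : complex.Re (a%:C * u) = a * complex.Re u.
Proof. by case: u => b c /=; rewrite mul0r subr0. Qed.

Lemma ReJ (u : R[i]) : complex.Re (u^*) = complex.Re u.
Proof. by case: u. Qed.

Lemma rinnerC x y : rinner x y = rinner y x.
Proof. by rewrite /rinner innerC ReJ. Qed.

Lemma rinnerDl x y z : rinner (x + y) z = rinner x z + rinner y z.
Proof. by rewrite /rinner linearDl ReD. Qed.

Lemma rinnerNl x y : rinner (- x) y = - rinner x y.
Proof. by rewrite /rinner linearNl ReN. Qed.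

Lemma rinnerZl a x y : rinner (a%:C *: x) y = a * rinner x y.
Proof. by rewrite /rinner linearZl /= ReZ. Qed.

Lemma rinnerDr x y z : rinner x (y + z) = rinner x y + rinner x z.
Proof. by rewrite !(rinnerC x) rinnerDl. Qed.

Lemma rinnerNr x y : rinner x (- y) = - rinner x y.
Proof. by rewrite !(rinnerC x) rinnerNl. Qed.

Lemma rinnerZr a x y : rinner x (a%:C *: y) = a * rinner x y.
Proof. by rewrite !(rinnerC x) rinnerZl. Qed.

Lemma rinnerxx x : rinner x x = hnorm x ^+ 2.
Proof. by rewrite /rinner -hnormX. Qed.

Lemma hnorm0 : hnorm (0 : H) = 0.
Proof. by rewrite /hnorm normr0. Qed.

Lemma hnorm_opp x : hnorm (- x) = hnorm x.
Proof. by rewrite /hnorm normrN. Qed.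

Lemma hnorm_eq0 x : (hnorm x == 0) = (x == 0).
Proof.
by rewrite -(normr_eq0 x) hnormE -[0%R in RHS]/(0%:C) (inj_eq (@complexI R)).
Qed.

Lemma hnorm_le0 x : hnorm x <= 0 -> x = 0.
Proof.
by move=> x0; apply/eqP; rewrite -hnorm_eq0 eq_le x0 hnorm_ge0.
Qed.

Lemma rinner_le x y : `|rinner x y| <= hnorm x * hnorm y.
Proof.
rewrite -(@lecR R) rmorphM /= -!hnormE.
exact: le_trans (normc_ge_Re _) (cauchy_schwarz _ _).
Qed.

End InnerProduct.

(** * Bounded operators, adjoints and positivity *)

Section Operators.
Variables (R : realType) (H : hilbertType R).
Implicit Types (x y z : H) (A B : bop H) (a K M : R).

Lemma bop0E x : (0 : bop H) x = 0. Proof. by []. Qed.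
Lemma bop1E x : (1 : bop H) x = x. Proof. by []. Qed.
Lemma bopDE A B x : (A + B) x = A x + B x. Proof. by []. Qed.
Lemma bopNE A x : (- A) x = - A x. Proof. by []. Qed.
Lemma bopME A B x : (A * B) x = A (B x). Proof. by []. Qed.

Lemma bop_linear0 A : A 0 = 0. Proof. exact: linear0. Qed.
Lemma bop_linearD A x y : A (x + y) = A x + A y. Proof. exact: linearD. Qed.
Lemma bop_linearN A x : A (- x) = - A x. Proof. exact: linearN. Qed.
Lemma bop_linearZ A k x : A (k *: x) = k *: A x. Proof. exact: linearZ. Qed.

Lemma bopXSE A n x : (A ^+ n.+1) x = (A ^+ n) (A x).
Proof. by rewrite exprSr bopME. Qed.

(** The operator norm of [A] is at most [K]. When [H] is not zero this forces
    [0 <= K]. *)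
Definition bop_le_norm (K : R) A := forall x, hnorm (A x) <= K * hnorm x.

Lemma bop_le_norm_exists A : exists2 K : R, 0 < K & bop_le_norm K A.
Proof.
have [M M0 AM] := bop_bound A.
exists (complex.Re M + 1) => [|x].
  by rewrite ltr_wpDl// -(@lecR R) (RRe_real (ger0_real M0)).
apply: (@le_trans _ _ (complex.Re M * hnorm x)); last first.
  by rewrite ler_wpM2r ?hnorm_ge0// lerDl.
rewrite -(@lecR R) rmorphM /= (RRe_real (ger0_real M0)).
by rewrite -!hnormE; exact: AM.
Qed.

Lemma bop_of_le_norm (f : H -> H) (K : R) :
  (forall x, hnorm (f x) <= K * hnorm x) -> bounded_op f.
Proof.
by move=> fK; exists K%:C => x; rewrite !hnormE -rmorphM lecR.
Qed.

Lemma scalar_bop_linear a : linear (fun x : H => a%:C *: x).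
Proof. by move=> k x y; rewrite scalerDr !scalerA mulrC. Qed.

Lemma scalar_bop_bounded a : bounded_op (fun x : H => a%:C *: x).
Proof. by exists `|a%:C| => x; rewrite normrZ. Qed.

(** The operator [a 1], for a real scalar [a]. *)
Definition scalar_bop a : bop H :=
  Bop (scalar_bop_linear a) (scalar_bop_bounded a).

Lemma scalar_bopE a x : scalar_bop a x = a%:C *: x. Proof. by []. Qed.

Lemma adjoint_unique A B :
  (forall x y, inner (A x) y = inner x (B y)) -> adjoint A = B.
Proof.
by move=> AB; apply: bopP => y; apply: inner_ext => z; rewrite -adjointP AB.
Qed.

Lemma adjointPr A x y : inner x (A y) = inner (adjoint A x) y.
Proof. by rewrite innerC adjointP -innerC. Qed.

Lemma adjointK A : adjoint (adjoint A) = A.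
Proof. by apply: adjoint_unique => x y; rewrite -adjointPr. Qed.

Lemma adjointM A B : adjoint (A * B) = adjoint B * adjoint A.
Proof. by apply: adjoint_unique => x y; rewrite !bopME !adjointP. Qed.

Lemma adjoint1 : adjoint (1 : bop H) = 1.
Proof. by apply: adjoint_unique. Qed.

Lemma adjointD A B : adjoint (A + B) = adjoint A + adjoint B.
Proof.
by apply: adjoint_unique => x y; rewrite !bopDE linearDl linearDr /= !adjointP.
Qed.

Lemma adjointN A : adjoint (- A) = - adjoint A.
Proof.
by apply: adjoint_unique => x y; rewrite !bopNE linearNl linearNr /= adjointP.
Qed.

Lemma adjoint_scalar a : adjoint (scalar_bop a) = scalar_bop a.
Proof.
apply: adjoint_unique => x y; rewrite !scalar_bopE linearZl linearZr /=.
by congr (_ * _); apply/esym/CrealP; apply/complex_realP; exists a.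
Qed.

Lemma adjointX A n : adjoint (A ^+ n) = adjoint A ^+ n.
Proof.
by elim: n => [|n IH]; rewrite ?adjoint1// exprS adjointM IH -exprSr.
Qed.

Lemma rinner_adj A x y : rinner (A x) y = rinner x (adjoint A y).
Proof. by rewrite /rinner adjointP. Qed.

Lemma adjoint_le_norm K A : bop_le_norm K A -> bop_le_norm K (adjoint A).
Proof.
move=> AK x; set y := adjoint A x.
have [y0|y0] := leP (hnorm y) 0.
  exact: le_trans y0 (le_trans (hnorm_ge0 _) (AK x)).
rewrite -(ler_pM2r y0) -expr2 -rinnerxx {2}/y -rinner_adj.
apply: le_trans (ler_norm _) _; apply: le_trans (rinner_le _ _) _.
by rewrite mulrAC ler_wpM2r ?hnorm_ge0.
Qed.

(** Polarization: over the complex scalars the quadratic form determines the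
    operator. *)
Lemma quadratic_eq0 A : (forall x, inner (A x) x = 0) -> A = 0.
Proof.
move=> A0; apply: bopP => x; apply: inner_ext => z.
rewrite linear0r innerC -[RHS]conjC0; congr (_^*).
have E (k : R[i]) : k^* * inner (A x) z + k * inner (A z) x = 0.
  have := A0 (x + k *: z).
  rewrite bop_linearD bop_linearZ linearDl !linearDr /=.
  rewrite !linearZl !linearZr /= !A0.
  by rewrite !mulr0 add0r addr0.
(* With u = <A x, z> and v = <A z, x>, k = 1 gives u + v = 0, and k = i
   gives i (v - u) = 0. *)
have := E 1; have := E 'i; rewrite conjCi conjC1 !mul1r mulNr.
move=> /eqP; rewrite addrC subr_eq0 => /eqP /(mulfI (neq0Ci _)) ->.
by move/eqP; rewrite -mulr2n mulrn_eq0 => /eqP.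
Qed.

Definition self_adjoint A := adjoint A = A.

Lemma positive_self_adjoint A : positive A -> self_adjoint A.
Proof.
move=> A0; apply/eqP; rewrite -subr_eq0; apply/eqP; apply: quadratic_eq0 => x.
rewrite bopDE bopNE linearDl linearNl /= -adjointPr.
have := ger0_real (A0 x); rewrite CrealE => /eqP.
by rewrite -innerC => ->; rewrite subrr.
Qed.

(** The quadratic form [x |-> Re <A x, x>]. *)
Definition qform A x := rinner (A x) x.

Lemma positiveE A x : positive A -> inner (A x) x = (qform A x)%:C.
Proof. by move=> A0; rewrite /qform /rinner RRe_real// ger0_real. Qed.

Lemma qform_ge0 A x : positive A -> 0 <= qform A x.
Proof. by move=> A0; rewrite -(@lecR R) -positiveE. Qed.

Lemma self_adjoint_rinner A x y :
  self_adjoint A -> rinner (A x) y = rinner x (A y).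
Proof. by move=> As; rewrite rinner_adj As. Qed.

Lemma self_adjoint_positive A :
  self_adjoint A -> (forall x, 0 <= qform A x) -> positive A.
Proof.
move=> As A0 x; have : inner (A x) x \is Num.real.
  by rewrite CrealE -innerC adjointP As.
by move/RRe_real <-; rewrite lecR; exact: A0.
Qed.

Lemma qform_le K A x : bop_le_norm K A -> qform A x <= K * hnorm x ^+ 2.
Proof.
move=> AK; apply: le_trans (ler_norm _) _; apply: le_trans (rinner_le _ _) _.
by rewrite expr2 mulrA ler_wpM2r ?hnorm_ge0.
Qed.

(** For [0 <= A <= M] one has [A^2 <= M A]: evaluate the form of [A] at
    [M x - A x]. *)
Lemma positive_hnorm_le A M : positive A -> 0 < M ->
  (forall x, qform A x <= M * hnorm x ^+ 2) ->
  forall x, hnorm (A x) ^+ 2 <= M * qform A x.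
Proof.
move=> A0 M0 AM x.
have As := positive_self_adjoint A0.
have := qform_ge0 (M%:C *: x - A x) A0; have := AM (A x).
rewrite /qform bop_linearD bop_linearN bop_linearZ.
rewrite !(rinnerDl, rinnerNl, rinnerZl).
rewrite !(rinnerDr, rinnerNr, rinnerZr) (self_adjoint_rinner (A x) x As).
rewrite !rinnerxx -/(qform A x) -/(qform A (A x)).
move: (qform A x) (qform A (A x)) (hnorm (A x) ^+ 2) => v u w h1 h2.
have : 0 <= M * (M * v - w) by nra.
by rewrite pmulr_rge0// subr_ge0.
Qed.

Lemma positive_invertible_coercive A : positive A -> invertible A ->
  exists2 d : R, 0 < d & forall x, d * hnorm x ^+ 2 <= qform A x.
Proof.
move=> A0 [B [AB BA]].
have [K K0 BK] := bop_le_norm_exists B.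
have [M M0 AM] := bop_le_norm_exists A.
have K2M : 0 < K ^+ 2 * M by rewrite mulr_gt0// exprn_gt0.
exists (K ^+ 2 * M)^-1 => [|x]; first by rewrite invr_gt0.
rewrite mulrC ler_pdivrMr// mulrC -mulrA.
have AMx := positive_hnorm_le A0 M0 (fun x => qform_le x AM) x.
apply: le_trans (_ : K ^+ 2 * hnorm (A x) ^+ 2 <= _).
  rewrite -exprMn ler_pXn2r ?nnegrE ?hnorm_ge0 ?mulr_ge0 ?(ltW K0) ?hnorm_ge0//.
  by have := BK (A x); rewrite -bopME BA.
by rewrite ler_pM2l ?exprn_gt0.
Qed.

End Operators.

(** * Strong limits and fixed points in the ball of operators *)

Section Limits.
Variables (R : realType) (H : hilbertType R).
Implicit Types (x : H) (A B X Y : bop H) (r e K C : R).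

(** Convergence in the strong operator topology. *)
Definition strong_cvg (A_ : nat -> bop H) A :=
  forall x, (fun n => A_ n x) @ \oo --> A x.

Lemma hcvgP (u : nat -> H) x : u @ \oo --> x <->
  (forall e, 0 < e -> exists N, forall n, (N <= n)%N -> hnorm (x - u n) < e).
Proof.
split=> [/cvgrPdist_lt ux e e0|ux].
  have [|N _ NP] := ux e%:C; first by rewrite (@ltcR R 0).
  by exists N => n /NP /=; rewrite hnormE ltcR.
apply/cvgrPdist_lt => e e0.
have eE : e = (complex.Re e)%:C by rewrite RRe_real// gtr0_real.
have [|N NP] := ux (complex.Re e); first by rewrite -(@ltcR R 0) -eE.
by exists N => // n /= Nn; rewrite eE hnormE ltcR; exact: NP.
Qed.

Lemma hcauchy_cvg (u : nat -> H) :
  (forall e, 0 < e -> exists N, forall n, (N <= n)%N ->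
    hnorm (u N - u n) < e) ->
  cvg (u @ \oo).
Proof.
move=> uc; apply: cauchy_cvg; apply: (@cauchy_exP R[i] H) => e e0.
have eE : e = (complex.Re e)%:C by rewrite RRe_real// gtr0_real.
have [|N NP] := uc (complex.Re e); first by rewrite -(@ltcR R 0) -eE.
exists (u N); exists N => // n /= Nn.
by rewrite -ball_normE /= eE hnormE ltcR; exact: NP.
Qed.

Lemma strong_limit (A_ : nat -> bop H) K :
  (forall n, bop_le_norm K (A_ n)) ->
  (forall x e, 0 < e -> exists N, forall n, (N <= n)%N ->
    hnorm (A_ N x - A_ n x) < e) ->
  exists2 A, bop_le_norm K A & strong_cvg A_ A.
Proof.
move=> AK Ac.
pose f x : H := lim ((fun n => A_ n x) @ \oo).
have fP x : (fun n => A_ n x) @ \oo --> f x by exact: (hcauchy_cvg (Ac x)).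
have fl : linear f.
  move=> a x y.
  apply: (cvg_unique _ (fP (a *: x + y))); first exact: norm_hausdorff.
  rewrite /=; under eq_fun do rewrite bop_linearD bop_linearZ.
  by apply: cvgD; [apply: cvgZl_tmp|]; exact: fP.
have fK x : hnorm (f x) <= K * hnorm x.
  apply/ler_addgt0Pr => e e0.
  have [N /(_ N (leqnn N)) fN] := (hcvgP _ _).1 (fP x) e e0.
  rewrite -[f x](subrK (A_ N x)); apply: le_trans (hnorm_triangle _ _) _.
  by rewrite [leLHS]addrC; apply: lerD; [exact: AK|exact: ltW].
by exists (Bop fl (bop_of_le_norm fK)).
Qed.

Lemma geometric_small r C e : 0 <= r -> r < 1 -> 0 < e ->
  exists N, forall n, (N <= n)%N -> r ^+ n * C < e.
Proof.
move=> r0 r1 e0.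
have : (fun n => r ^+ n * C) @ \oo --> 0 * C.
  by apply: cvgMr_tmp; apply: cvg_expr; rewrite ger0_norm.
rewrite mul0r => /cvgrPdist_lt /(_ e e0) [N _ NP].
exists N => n /NP /=; rewrite sub0r normrN; exact: le_lt_trans (ler_norm _).
Qed.

Lemma bop_eq_geometric X Y r C : 0 <= r -> r < 1 ->
  (forall n, bop_le_norm (r ^+ n * C) (X - Y)) -> X = Y.
Proof.
move=> r0 r1 XY; apply: bopP => x; apply/eqP; rewrite -subr_eq0; apply/eqP.
apply: hnorm_le0; apply/ler_addgt0Pr => e e0; rewrite add0r.
have [N /(_ N (leqnn N)) Ne] := geometric_small (C * hnorm x) r0 r1 e0.
by apply: le_trans (XY N x) _; rewrite -mulrA ltW.
Qed.

Lemma bop_le_normN K A : bop_le_norm K A -> bop_le_norm K (- A).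
Proof. by move=> AK x; rewrite bopNE hnorm_opp. Qed.

Lemma bop_le_normD K C A B :
  bop_le_norm K A -> bop_le_norm C B -> bop_le_norm (K + C) (A + B).
Proof.
move=> AK BC x; rewrite bopDE; apply: le_trans (hnorm_triangle _ _) _.
by rewrite mulrDl lerD.
Qed.

Lemma bop_le_normM K C A B : 0 <= K ->
  bop_le_norm K A -> bop_le_norm C B -> bop_le_norm (K * C) (A * B).
Proof.
move=> K0 AK BC x; rewrite bopME; apply: le_trans (AK _) _.
by rewrite -mulrA ler_wpM2l.
Qed.

Lemma bop_le_norm_scalar K : 0 <= K -> bop_le_norm K (scalar_bop H K).
Proof. by move=> K0 x; rewrite scalar_bopE hnormZ_ge0. Qed.

(** Uniqueness in the Banach fixed point theorem on the ball of radius [K] of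
    the operators. Distances are expressed by [bop_le_norm]. *)
Lemma bop_fixpoint_unique (Phi : bop H -> bop H) r K :
  0 <= r -> r < 1 -> 0 <= K ->
  (forall C X Y, 0 <= C -> bop_le_norm K X -> bop_le_norm K Y ->
    bop_le_norm C (X - Y) -> bop_le_norm (r * C) (Phi X - Phi Y)) ->
  forall X Y, bop_le_norm K X -> bop_le_norm K Y ->
    Phi X = X -> Phi Y = Y -> X = Y.
Proof.
move=> r0 r1 K0 Phir X Y XK YK XE YE.
apply: (bop_eq_geometric r0 r1 (C := K + K)) => n.
elim: n => [|n IH].
  by rewrite expr0 mul1r; apply: bop_le_normD => //; exact: bop_le_normN.
rewrite exprS -mulrA -XE -YE; apply: Phir => //.
by rewrite mulr_ge0 ?addr_ge0 ?exprn_ge0.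
Qed.

(** Existence in the same theorem: the iterates [Phi^n 0] satisfy
    [|X_n - X_(n+p)| <= r^n K], hence converge. *)
Lemma bop_fixpoint (Phi : bop H -> bop H) r K : 0 <= r -> r < 1 -> 0 <= K ->
  (forall X, bop_le_norm K X -> bop_le_norm K (Phi X)) ->
  (forall C X Y, 0 <= C -> bop_le_norm K X -> bop_le_norm K Y ->
    bop_le_norm C (X - Y) -> bop_le_norm (r * C) (Phi X - Phi Y)) ->
  exists2 X, bop_le_norm K X & Phi X = X.
Proof.
move=> r0 r1 K0 PhiK Phir; pose X_ n := iter n Phi 0.
have XK n : bop_le_norm K (X_ n).
  elim: n => [|n IH]; last by rewrite /X_ iterS; exact: PhiK.
  by move=> x; rewrite bop0E hnorm0 mulr_ge0// hnorm_ge0.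
have Xr n p : bop_le_norm (r ^+ n * K) (X_ n - X_ (n + p)%N).
  elim: n => [|n IH]; last first.
    by rewrite exprS -mulrA; apply: Phir; rewrite // mulr_ge0 ?exprn_ge0.
  rewrite add0n expr0 mul1r /X_ /= -/(X_ p) sub0r; exact: bop_le_normN.
have [X XK' Xcvg] : exists2 X, bop_le_norm K X & strong_cvg X_ X.
  apply: strong_limit => // x e e0.
  have [N /(_ N (leqnn N)) Ne] := geometric_small (K * hnorm x) r0 r1 e0.
  exists N => n /subnKC <-; apply: le_lt_trans Ne.
  by have := Xr N (n - N)%N x; rewrite bopDE bopNE -mulrA.
exists X => //.
have Xlim n : bop_le_norm (r ^+ n * K) (X - X_ n).
  move=> x; apply/ler_addgt0Pr => e e0.
  have [N NP] := (hcvgP _ _).1 (Xcvg x) e e0.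
  have /ltW h1 := NP (n + N)%N (leq_addl _ _); have h2 := Xr n N x.
  rewrite !bopDE !bopNE in h2 *.
  have -> : X x - X_ n x = - (X_ n x - X_ (n + N)%N x) + (X x - X_ (n + N)%N x).
    by rewrite opprB [RHS]addrC addrA subrK.
  by apply: le_trans (hnorm_triangle _ _) _; rewrite hnorm_opp lerD.
apply: (bop_eq_geometric r0 r1 (C := r * K + r * K)) => n.
rewrite mulrDr !mulrA -!exprSr.
have -> : Phi X - X = (Phi X - X_ n.+1) + (- (X - X_ n.+1)).
  by rewrite opprB addrA subrK.
apply: bop_le_normD; last by apply: bop_le_normN.
by rewrite exprS -mulrA; apply: Phir; rewrite // mulr_ge0 ?exprn_ge0.
Qed.

(** The inverse of [1 - A] for [|A| <= r < 1]: the fixed point of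
    [X |-> 1 + A X] is a right inverse, and [X (1 - A) - 1] is fixed by left
    multiplication by [A], hence zero. *)
Lemma neumann A r : 0 <= r -> r < 1 -> bop_le_norm r A -> invertible (1 - A).
Proof.
move=> r0 r1 Ar.
have r1' : 0 < 1 - r by rewrite subr_gt0.
have [X XK XE] : exists2 X, bop_le_norm (1 - r)^-1 X & 1 + A * X = X.
  apply: (@bop_fixpoint (fun X => 1 + A * X) r) => //.
  - by rewrite invr_ge0 ltW.
  - move=> X XK; have -> : (1 - r)^-1 = 1 + r * (1 - r)^-1.
      by field; rewrite gt_eqF.
    by apply: bop_le_normD; [move=> x; rewrite mul1r|exact: bop_le_normM].
  - move=> C X Y _ _ _ XY.
    by rewrite opprD addrACA subrr add0r -mulrBr; exact: bop_le_normM.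
have lX : (1 - A) * X = 1 by rewrite mulrBl mul1r -{1}XE addrK.
exists X; split => //.
apply/eqP; rewrite -subr_eq0; apply/eqP.
set Y := _ - _.
have YE : A * Y = Y.
  apply/eqP; rewrite -subr_eq0 -opprB oppr_eq0 -{1}[Y]mul1r -mulrBl /Y mulrBr.
  by rewrite mulrA lX mul1r mulr1 subrr.
have [K K0 YK] := bop_le_norm_exists Y.
apply: (bop_eq_geometric r0 r1 (C := K)); rewrite subr0.
elim=> [|n IH]; first by rewrite mul1r.
by rewrite exprS -YE -mulrA; exact: bop_le_normM.
Qed.

End Limits.

(** * Square roots of positive invertible operators *)

Section SquareRoot.
Variables (R : realType) (H : hilbertType R).
Implicit Types (x : H) (A S X Y : bop H) (r K C a b c d : R).

Local Notation sc := (scalar_bop H).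

Lemma scalar_bopM a b : sc (a * b) = sc a * sc b.
Proof. by apply: bopP => x; rewrite bopME !scalar_bopE rmorphM scalerA. Qed.

Lemma scalar_bop1 : sc 1 = 1.
Proof. by apply: bopP => x; rewrite scalar_bopE scale1r. Qed.

Lemma scalar_bopD a b : sc (a + b) = sc a + sc b.
Proof. by apply: bopP => x; rewrite bopDE !scalar_bopE rmorphD scalerDl. Qed.

Lemma scalar_bopC a A : A * sc a = sc a * A.
Proof. by apply: bopP => x; rewrite !bopME !scalar_bopE bop_linearZ. Qed.

Lemma scalar_bopK a : a != 0 -> sc a * sc a^-1 = 1.
Proof. by move=> a0; rewrite -scalar_bopM divff// scalar_bop1. Qed.

Lemma bop_le_norm_trans K C A : K <= C -> bop_le_norm K A -> bop_le_norm C A.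
Proof.
by move=> KC AK x; apply: le_trans (AK x) _; rewrite ler_wpM2r// hnorm_ge0.
Qed.

(** An operator with [A >= d > 0] is [c (1 - B)] where [c > 0] and [B] is
    self-adjoint of norm at most [r < 1]. *)
Lemma coercive_contraction A d : positive A -> 0 < d ->
  (forall x, d * hnorm x ^+ 2 <= qform A x) ->
  exists c r, [/\ 0 < c, 0 <= r, r < 1, self_adjoint (1 - sc c^-1 * A)
                & bop_le_norm r (1 - sc c^-1 * A)].
Proof.
move=> A0 d0 Ad; have [M M0 AM] := bop_le_norm_exists A.
(* With A <= M and c = M + d, one gets 0 <= 1 - A / c <= M / c < 1. *)
have c0 : 0 < M + d by rewrite addr_gt0.
set c := M + d in c0; pose B : bop H := 1 - sc c^-1 * A.
have r0 : 0 < M / c by rewrite divr_gt0.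
have BE x : qform B x = hnorm x ^+ 2 - c^-1 * qform A x.
  rewrite /qform /B bopDE bopNE bopME scalar_bopE bop1E.
  by rewrite rinnerDl rinnerNl rinnerZl rinnerxx.
have Bs : self_adjoint B.
  rewrite /self_adjoint /B adjointD adjointN adjoint1 adjointM adjoint_scalar.
  by rewrite (positive_self_adjoint A0) scalar_bopC.
have B0 : positive B.
  apply: self_adjoint_positive => // x; rewrite BE subr_ge0 mulrC ler_pdivrMr//.
  apply: le_trans (qform_le x AM) _.
  by rewrite mulrC ler_wpM2l ?exprn_ge0 ?hnorm_ge0// lerDl ltW.
have Br x : qform B x <= M / c * hnorm x ^+ 2.
  rewrite BE lerBlDr -lerBlDl -{1}[_ ^+ 2]mul1r -mulrBl.
  have -> : 1 - M / c = c^-1 * d by rewrite /c; field; rewrite gt_eqF.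
  by rewrite -mulrA ler_wpM2l// invr_ge0 ltW.
exists c, (M / c); split => //; first exact: ltW.
  by rewrite ltr_pdivrMr// mul1r ltrDl.
move=> x; rewrite -(@ler_pXn2r _ 2) ?nnegrE ?hnorm_ge0//; last first.
  by rewrite mulr_ge0 ?hnorm_ge0 ?ltW.
apply: le_trans (positive_hnorm_le B0 r0 Br x) _.
by rewrite exprMn (expr2 (M / c)) -(mulrA (M / c)) ler_wpM2l// ltW.
Qed.

Lemma coercive_invertible A d : positive A -> 0 < d ->
  (forall x, d * hnorm x ^+ 2 <= qform A x) -> invertible A.
Proof.
move=> A0 d0 Ad.
have [c [r [c0 r0 r1 _ /(neumann r0 r1)]]] := coercive_contraction A0 d0 Ad.
rewrite opprB addrC subrK => -[X [AX XA]].
by exists (sc c^-1 * X); rewrite mulrA scalar_bopC AX -scalar_bopC -mulrA.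
Qed.

Lemma invertible_square A S : S * S = A -> invertible A -> invertible S.
Proof.
move=> SA [B [AB BA]]; exists (S * B); split; first by rewrite mulrA SA.
have -> : S * B = B * S.
  by rewrite -[LHS]mul1r -BA -SA -!mulrA (mulrA S S B) SA AB mulr1.
by rewrite -mulrA SA.
Qed.

(** [S] is self-adjoint and invertible, but positivity of [S] is neither
    claimed nor needed. *)
Theorem positive_square_root A : positive A -> invertible A ->
  exists S, [/\ self_adjoint S, invertible S & S * S = A].
Proof.
move=> A0 Ai; have [d d0 Ad] := positive_invertible_coercive A0 Ai.
have [c [r [c0 r0 r1 Bs Br]]] := coercive_contraction A0 d0 Ad.
set B := 1 - _ in Bs Br.
pose Phi Y := sc 2^-1 * (B + Y * Y).
have h0 : 0 <= 2^-1 :> R by rewrite invr_ge0.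
have PhiK Y : bop_le_norm r Y -> bop_le_norm r (Phi Y).
  move=> Yr; apply: (@bop_le_norm_trans (2^-1 * (r + r * r))); first by nra.
  apply: bop_le_normM => //; first exact: bop_le_norm_scalar.
  by apply: bop_le_normD => //; exact: bop_le_normM.
have Phir C X Y : 0 <= C -> bop_le_norm r X -> bop_le_norm r Y ->
    bop_le_norm C (X - Y) -> bop_le_norm (r * C) (Phi X - Phi Y).
  move=> C0 Xr Yr XY.
  have -> : Phi X - Phi Y = sc 2^-1 * (X * (X - Y) + (X - Y) * Y).
    rewrite -mulrBr; congr (_ * _).
    by rewrite opprD addrACA subrr add0r mulrBr mulrBl addrA subrK.
  have -> : r * C = 2^-1 * (r * C + C * r) by field.
  apply: bop_le_normM => //; first exact: bop_le_norm_scalar.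
  by apply: bop_le_normD; exact: bop_le_normM.
have [Y Yr YE] := bop_fixpoint r0 r1 r0 PhiK Phir.
(* The adjoint of Y is a fixed point in the same ball. *)
have Ys : self_adjoint Y.
  apply: (bop_fixpoint_unique r0 r1 r0 Phir) => //.
    exact: adjoint_le_norm.
  rewrite -{2}YE /Phi adjointM adjoint_scalar adjointD adjointM Bs.
  by rewrite scalar_bopC.
have YY : Y * Y = Y + Y - B.
  have : sc 2 * Phi Y = Y + Y.
    by rewrite YE (_ : 2 = 1 + 1)// scalar_bopD scalar_bop1 mulrDl mul1r.
  by rewrite /Phi mulrA scalar_bopK ?mul1r// => <-; rewrite addrC addKr.
have sqE : (1 - Y) * (1 - Y) = sc c^-1 * A.
  rewrite mulrBl mul1r mulrBr mulr1 YY -addrA -opprD.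
  have -> : Y + (Y - (Y + Y - B)) = B by rewrite addrA subKr.
  by rewrite /B subKr.
have SA : sc (Num.sqrt c) * (1 - Y) * (sc (Num.sqrt c) * (1 - Y)) = A.
  rewrite mulrA -(mulrA _ (1 - Y)) scalar_bopC mulrA -scalar_bopM -expr2.
  rewrite sqr_sqrtr ?(ltW c0)// -mulrA sqE mulrA scalar_bopK ?mul1r//.
  by rewrite gt_eqF.
exists (sc (Num.sqrt c) * (1 - Y)); split => //.
  2: exact: invertible_square SA Ai.
rewrite /self_adjoint adjointM adjoint_scalar adjointD adjointN adjoint1 Ys.
by rewrite scalar_bopC.
Qed.

End SquareRoot.

(** * Differences of bounded sequences *)

Section Differences.
Variable R : realType.
Implicit Types (a c : nat -> R) (K : R).

(** The backward difference operator, identity minus shift. *)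
Definition bdiff a : nat -> R := fun n => a n - a n.+1.

Lemma iter_bdiffE m a n : iter m bdiff a n =
  \sum_(j < m.+1) (-1) ^+ j * 'C(m, j)%:R * a (n + j)%N.
Proof.
elim: m a => [|m IH] a.
  by rewrite big_ord_recl big_ord0 /= addn0 bin0 expr0 !mul1r addr0.
rewrite iterSr IH; under eq_bigr do rewrite /bdiff mulrBr.
pose F j := (-1) ^+ j * 'C(m, j)%:R * a (n + j)%N.
have Fm : F m.+1 = 0 by rewrite /F bin_small// mulr0 mul0r.
have FE : \sum_(j < m.+1) F j = F 0 + \sum_(j < m.+1) F j.+1.
  rewrite -(big_ord_recl _ (fun j => F (val j))) [RHS]big_ord_recr /=.
  by rewrite Fm addr0.
rewrite sumrB FE [RHS]big_ord_recl -addrA; congr (_ + _).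
  by rewrite /F !bin0.
rewrite -sumrB; apply: eq_bigr => j _.
rewrite lift0 binS natrD /F addnS exprS; ring.
Qed.

Lemma iter_bdiff_bounded m a K : (forall n, `|a n| <= K) ->
  exists C, forall n, `|iter m bdiff a n| <= C.
Proof.
move=> aK; elim: m => [|m [C IH]]; first by exists K.
exists (C + C) => n; rewrite iterS /bdiff.
by apply: le_trans (ler_normB _ _) _; rewrite lerD.
Qed.

Lemma bounded_bdiff2 c K : (forall n, `|c n| <= K) ->
  (forall n, bdiff (bdiff c) n <= 0) -> forall n, bdiff c n <= 0.
Proof.
move=> cK c2 n0; rewrite leNgt; apply/negP => e0; set e := bdiff c n0 in e0.
have bE k : e <= bdiff c (n0 + k)%N.
  elim: k => [|k IH]; first by rewrite addn0.
  by rewrite addnS (le_trans IH)// -subr_le0; exact: c2.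
have cE k : k%:R * e <= c n0 - c (n0 + k)%N.
  elim: k => [|k IH]; first by rewrite addn0 mul0r subrr.
  have := bE k; rewrite /bdiff addnS -natr1 mulrDl mul1r; lra.
pose k := (Num.truncn (2 * K / e)).+1.
have : 2 * K < k%:R * e by rewrite -ltr_pdivrMr// truncnS_gt.
have := cE k; have := cK n0; have := cK (n0 + k)%N.
rewrite !ler_norml; lra.
Qed.

(** If the difference of some order [m + 1] of a bounded sequence is
    nonpositive, then the sequence is nondecreasing. *)
Lemma bounded_bdiff m a K : (forall n, `|a n| <= K) ->
  (forall n, iter m.+1 bdiff a n <= 0) -> forall n, bdiff a n <= 0.
Proof.
move=> aK; elim: m => [//|m IH] aD; apply: IH.
have [C aC] := iter_bdiff_bounded m aK.
by rewrite iterS; apply: (bounded_bdiff2 aC) => n; rewrite -!iterS.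
Qed.

End Differences.

(** * Defect operators and invariance *)

Section Defect.
Variables (R : realType) (H : hilbertType R).
Implicit Types (x : H) (A P Q T : bop H) (K : R).

Lemma qformM T P n x :
  qform (adjoint T ^+ n * P * T ^+ n) x = qform P ((T ^+ n) x).
Proof. by rewrite /qform !bopME -adjointX rinner_adj adjointK. Qed.

Lemma qformD A B x : qform (A + B) x = qform A x + qform B x.
Proof. by rewrite /qform bopDE rinnerDl. Qed.

Lemma qformN A x : qform (- A) x = - qform A x.
Proof. by rewrite /qform bopNE rinnerNl. Qed.

Lemma qform0 x : qform 0 x = 0 :> R.
Proof. by rewrite -[X in qform X](subrr (0 : bop H)) qformD qformN subrr. Qed.

Lemma qformMn A n x : qform (A *+ n) x = qform A x *+ n.
Proof.
by elim: n => [|n IH]; rewrite ?mulr0n ?qform0// !mulrS qformD IH.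
Qed.

Lemma qform_sign n A x : qform ((-1) ^+ n * A) x = (-1) ^+ n * qform A x.
Proof.
rewrite -signr_odd -[in RHS]signr_odd.
by case: (odd n); rewrite ?expr0 ?mul1r// expr1 !mulN1r qformN.
Qed.

Lemma qform_defect m T P x : qform (defect m T P) x =
  \sum_(j < m.+1) (-1) ^+ j * 'C(m, j)%:R * qform P ((T ^+ j) x).
Proof.
rewrite /defect; elim/big_rec2: _ => [|j s A _ <-]; first exact: qform0.
by rewrite qformD qformMn qform_sign qformM mulrAC mulr_natr.
Qed.

(** Expansivity, evaluated at [T^n x], bounds the [m]-th difference of the
    sequence [<P T^k x, T^k x>] at the index [n]. *)
Lemma expansive_bdiff m P T x n : expansive m P T ->
  iter m (@bdiff R) (fun k => qform P ((T ^+ k) x)) n <= 0.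
Proof.
move=> Texp; have := qform_ge0 ((T ^+ n) x) Texp.
rewrite sub0r qformN oppr_ge0 qform_defect iter_bdiffE.
by under eq_bigr do rewrite -bopME -exprD addnC.
Qed.

Lemma op_isometric_invariant n Q T : (1 <= n)%N ->
  adjoint T * Q * T = Q -> op_isometric n Q T.
Proof.
move=> n1 TQ; have TjQ j : adjoint T ^+ j * Q * T ^+ j = Q.
  elim: j => [|j IH]; first by rewrite !expr0 mul1r mulr1.
  by rewrite exprSr exprS mulrA -!(mulrA (adjoint T ^+ j)) TQ mulrA.
rewrite /op_isometric /defect; under eq_bigr do rewrite TjQ -mulrnAl.
rewrite -mulr_suml.
(* The alternating sum of binomials is (1 - 1)^n in the ring of operators. *)
rewrite [X in X * _](_ : _ = (1 - 1) ^+ n).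
  by rewrite subrr expr0n gtn_eqF// mul0r.
rewrite (exprBn_comm n (commr_refl (1 : bop H))).
by apply: eq_bigr => j _; rewrite !expr1n !mulr1.
Qed.

Lemma invariant_qform Q T : positive Q ->
  (forall x, qform Q (T x) = qform Q x) -> adjoint T * Q * T = Q.
Proof.
move=> Q0 QT; apply/eqP; rewrite -subr_eq0; apply/eqP.
apply: quadratic_eq0 => x.
rewrite bopDE bopNE !bopME linearDl linearNl /= adjointP adjointK.
by rewrite !positiveE// QT subrr.
Qed.

End Defect.

(** * Power boundedness *)

Section PowerBounded.
Variables (R : realType) (H : hilbertType R).
Implicit Types (x : H) (A P Q T : bop H) (K : R).

Lemma opnormP A : bop_le_norm (opnorm A) A.
Proof.
move=> x; have [->|x0] := eqVneq x 0.
  by rewrite bop_linear0 hnorm0 mulr0.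
have nx : 0 < hnorm x by rewrite lt_def hnorm_eq0 x0 hnorm_ge0.
have [K K0 AK] := bop_le_norm_exists A.
rewrite mulrC -ler_pdivrMl// -hnormZ_ge0 ?invr_ge0 ?(ltW nx)//.
rewrite -bop_linearZ; apply: ub_le_sup; last first.
  exists ((hnorm x)^-1%:C *: x) => //=.
  by rewrite hnormZ_ge0 ?invr_ge0 ?(ltW nx)// mulVf ?gt_eqF.
exists K => _ [y /= y1 <-]; apply: le_trans (AK y) _.
by rewrite -[leRHS]mulr1 ler_wpM2l// ltW.
Qed.

Lemma opnorm_le A K : 0 <= K -> bop_le_norm K A -> opnorm A <= K.
Proof.
move=> K0 AK; apply: ge_sup.
  by exists (hnorm (A 0)), 0 => //=; rewrite hnorm0.
move=> _ [y /= y1 <-]; apply: le_trans (AK y) _.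
by rewrite -[leRHS]mulr1 ler_wpM2l.
Qed.

Lemma power_boundedP T : power_bounded T <->
  exists2 M : R, 0 < M & forall n, bop_le_norm M (T ^+ n).
Proof.
split=> [[M M0 TM]|[M M0 TM]]; exists M => //.
  move=> n; apply: bop_le_norm_trans (@opnormP _); rewrite -lee_fin.
  by apply: le_trans TM; apply: ereal_sup_ubound; exists n.
apply: ge_ereal_sup => _ [n _ <-]; rewrite lee_fin.
by apply: opnorm_le; rewrite ?ltW.
Qed.

End PowerBounded.

(** * Invariant positive operators *)

Section Invariant.
Variables (R : realType) (H : hilbertType R).
Implicit Types (x y : H) (A P Q S T : bop H) (K a b : R).

(** Real parts suffice to test self-adjointness. *)
Lemma self_adjointP A :
  (forall x y, rinner (A x) y = rinner x (A y)) -> self_adjoint A.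
Proof.
move=> AA; apply: bopP => y; apply/eqP; rewrite -subr_eq0; apply/eqP.
apply: hnorm_le0; rewrite -(@ler_pXn2r _ 2) ?nnegrE ?hnorm_ge0//.
rewrite expr0n /= -rinnerxx rinnerDr rinnerNr -AA -rinner_adj.
by rewrite subrr.
Qed.

Lemma cvg_real_unique (u : nat -> R) a b :
  u @ \oo --> a -> u @ \oo --> b -> a = b.
Proof.
by move=> /(cvg_lim (@Rhausdorff R)) <- /(cvg_lim (@Rhausdorff R)) <-.
Qed.

Lemma rinner_cvg (A_ : nat -> bop H) A x y : strong_cvg A_ A ->
  (fun n => rinner (A_ n x) y) @ \oo --> rinner (A x) y.
Proof.
move=> /(_ x) /hcvgP Ax; apply/cvgrPdist_lt => e e0.
have y1 : 0 < hnorm y + 1 by rewrite ltr_wpDl ?hnorm_ge0.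
have [|N NP] := Ax (e / (hnorm y + 1)); first by rewrite divr_gt0.
exists N => // n /= /NP; rewrite ltr_pdivlMr// => h.
rewrite -rinnerNl -rinnerDl; apply: le_lt_trans (rinner_le _ _) _.
by apply: le_lt_trans h; rewrite ler_wpM2l ?hnorm_ge0// lerDl.
Qed.

(** A bounded nondecreasing sequence of positive operators converges strongly.
    For [n <= p], [positive_hnorm_le] applied to [A_p - A_n] bounds
    [|(A_p - A_n) x|^2] by [2 K <(A_p - A_n) x, x>], and these forms
    converge. *)
Lemma monotone_strong_limit (A_ : nat -> bop H) K : 0 < K ->
  (forall n, positive (A_ n)) -> (forall n, bop_le_norm K (A_ n)) ->
  (forall n x, qform (A_ n) x <= qform (A_ n.+1) x) ->
  exists Q, [/\ strong_cvg A_ Q, positive Q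
              & forall n x, qform (A_ n) x <= qform Q x].
Proof.
move=> K0 A0 AK Ainc.
have Amono x : {homo (fun n => qform (A_ n) x) : n p / (n <= p)%N >-> n <= p}.
  by apply/nondecreasing_seqP => n; exact: Ainc.
have Ale n x : qform (A_ n) x <= K * hnorm x ^+ 2 by exact: qform_le.
have dist n p x : (n <= p)%N -> hnorm (A_ p x - A_ n x) ^+ 2 <=
    (K + K) * (qform (A_ p) x - qform (A_ n) x).
  move=> np; rewrite -qformN -qformD -bopNE -bopDE.
  apply: positive_hnorm_le.
  - apply: self_adjoint_positive => [|z].
      rewrite /self_adjoint adjointD adjointN.
      by rewrite !(positive_self_adjoint (A0 _)).
    by rewrite qformD qformN subr_ge0; exact: Amono.
  - by rewrite addr_gt0.
  - move=> z; apply: qform_le; apply: bop_le_normD => //.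
    exact: bop_le_normN.
have [|Q QK AQ] := strong_limit AK.
  move=> x e e0; pose E := range (fun n => qform (A_ n) x).
  have Esup : has_sup E.
    split; first by exists (qform (A_ 0%N) x), 0%N.
    by exists (K * hnorm x ^+ 2) => _ [n _ <-].
  have KK : 0 < K + K by rewrite addr_gt0.
  have d0 : 0 < e ^+ 2 / (K + K) by rewrite divr_gt0 ?exprn_gt0.
  have [_ [N _ <-] NP] := sup_adherent d0 Esup.
  exists N => n Nn; rewrite hnorm_distC.
  rewrite -(@ltr_pXn2r _ 2) ?nnegrE ?hnorm_ge0 ?(ltW e0)//.
  apply: le_lt_trans (dist _ _ x Nn) _.
  rewrite mulrC -ltr_pdivlMr//.
  have : qform (A_ n) x <= sup E by apply: (ub_le_sup Esup.2); exists n.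
  by move: NP => /=; lra.
have Qlim x : (fun n => qform (A_ n) x) @ \oo --> qform Q x.
  exact: rinner_cvg.
have AleQ n x : qform (A_ n) x <= qform Q x.
  rewrite -(cvg_lim (@Rhausdorff R) (Qlim x)).
  apply: nondecreasing_cvgn_le; first exact: Amono.
  by apply/cvg_ex; exists (qform Q x).
exists Q; split => //.
apply: self_adjoint_positive => [|x]; last first.
  exact: le_trans (qform_ge0 x (A0 0%N)) (AleQ 0%N x).
apply: self_adjointP => x y.
apply: (cvg_real_unique (@rinner_cvg _ _ x y AQ)).
under eq_fun => n.
  rewrite (self_adjoint_rinner _ _ (positive_self_adjoint (A0 n))) rinnerC.
  over.
rewrite rinnerC; exact: rinner_cvg.
Qed.

Theorem power_bounded_expansive_invariant m P T :
  (1 <= m)%N -> positive P -> invertible P -> expansive m P T ->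
  power_bounded T ->
  exists Q, [/\ positive Q, invertible Q & adjoint T * Q * T = Q].
Proof.
case: m => // m _ P0 Pi Texp /power_boundedP[M M0 TM].
have [d d0 Pd] := positive_invertible_coercive P0 Pi.
have [C C0 PC] := bop_le_norm_exists P.
pose A_ n := adjoint T ^+ n * P * T ^+ n.
have AE n x : qform (A_ n) x = qform P ((T ^+ n) x) by exact: qformM.
have AK n : bop_le_norm (M * C * M) (A_ n).
  apply: bop_le_normM => //; first by rewrite ltW ?mulr_gt0.
  apply: bop_le_normM => //; first exact: ltW.
  by rewrite -adjointX; exact: adjoint_le_norm.
have A0 n : positive (A_ n).
  by move=> x; rewrite !bopME -adjointX adjointP adjointK; exact: P0.
have Ainc n x : qform (A_ n) x <= qform (A_ n.+1) x.
  rewrite -subr_le0 !AE.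
  apply: (@bounded_bdiff _ m (fun k => qform P ((T ^+ k) x))
    (M * C * M * hnorm x ^+ 2)).
    move=> k; rewrite ger0_norm ?qform_ge0// -AE; exact: qform_le.
  by move=> k; exact: expansive_bdiff.
have [|Q [AQ Q0 AleQ]] := monotone_strong_limit _ A0 AK Ainc.
  by rewrite !mulr_gt0.
exists Q; split => //.
  apply: (coercive_invertible Q0 d0) => x; apply: le_trans (Pd x) _.
  by have := AleQ 0%N x; rewrite AE.
apply: invariant_qform => // x.
apply: (cvg_real_unique (@rinner_cvg _ _ (T x) (T x) AQ)).
have -> : (fun n => rinner (A_ n (T x)) (T x)) = (fun n => qform (A_ n.+1) x).
  by apply/funext => n; rewrite -[LHS]/(qform (A_ n) (T x)) !AE bopXSE.
by move: (@rinner_cvg _ _ x x AQ); rewrite -cvg_shiftS.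
Qed.

Lemma invariant_C1dot_similar T Q :
  positive Q -> invertible Q -> adjoint T * Q * T = Q ->
  C1dot T /\ similar_to_isometry T.
Proof.
move=> Q0 Qi TQ; have [S [Ss Si SQ]] := positive_square_root Q0 Qi.
have normS x : hnorm (S x) ^+ 2 = qform Q x.
  by rewrite -rinnerxx -SQ /qform bopME -self_adjoint_rinner.
have ST x : hnorm (S (T x)) = hnorm (S x).
  apply: (pexpIrn (ltn0Sn 1)); rewrite ?nnegrE ?hnorm_ge0// !normS -[in RHS]TQ.
  by rewrite -[T in RHS]expr1 -[adjoint T]expr1 qformM expr1.
have [S' [SS' S'S]] := Si; split; last first.
  exists S, S', (S * T * S'); split => //; last first.
    by rewrite !mulrA S'S mul1r -mulrA S'S mulr1.
  by move=> x; rewrite !hnormE !bopME ST -bopME SS'.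
move=> x x0; have [K K0 SK] := bop_le_norm_exists S.
have STn n : hnorm (S ((T ^+ n) x)) = hnorm (S x).
  by elim: n => [|n IH] //; rewrite exprS bopME ST.
have Sx0 : 0 < hnorm (S x) / K.
  rewrite divr_gt0// lt_def hnorm_ge0 hnorm_eq0 andbT.
  apply: contra_neq x0 => Sx0.
  by rewrite -[x]bop1E -S'S bopME Sx0 bop_linear0.
apply: lt_le_trans Sx0 _; apply: lb_le_inf; first by exists (hnorm x), 0%N.
move=> _ [n _ <-]; rewrite ler_pdivrMr// mulrC -(STn n); exact: SK.
Qed.

Lemma similar_to_isometry_invariant T : similar_to_isometry T ->
  exists Q, [/\ positive Q, invertible Q & adjoint T * Q * T = Q].
Proof.
move=> [S [S' [V [SS' S'S Viso TE]]]].
have Q0 : positive (adjoint S * S).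
  by move=> x; rewrite bopME adjointP adjointK -normr_inner exprn_ge0.
exists (adjoint S * S); split => //.
  exists (S' * adjoint S'); split.
    by rewrite -mulrA (mulrA S) SS' mul1r -adjointM S'S adjoint1.
  by rewrite -mulrA (mulrA (adjoint S')) -adjointM SS' adjoint1 mul1r S'S.
apply: invariant_qform => // x.
have QE y : qform (adjoint S * S) y = hnorm (S y) ^+ 2.
  by rewrite /qform bopME rinner_adj adjointK rinnerxx.
rewrite !QE TE !bopME -[S (S' _)]bopME SS' bop1E.
by rewrite /hnorm Viso.
Qed.

(** The form [<Q x, y>] is an inner product. *)
Lemma weighted_dot Q : positive Q -> invertible Q ->
  exists B : {dot H for Num.conj}, forall x y, B x y = inner (Q x) y.
Proof.
move=> Q0 Qi; have [S [Ss [S' [_ S'S]] SQ]] := positive_square_root Q0 Qi.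
pose f x y : R[i] := inner (Q x) y.
have fl : bilinear_for ( *%R ) (Num.conj \; *%R) f.
  split=> [y|x] k u v; rewrite /f.
    by rewrite bop_linearD bop_linearZ linearDl linearZl.
  by rewrite linearDr linearZr.
have fh x y : f x y = (-1) ^+ false * (f y x)^*.
  rewrite expr0 mul1r /f -innerC adjointP.
  by rewrite (positive_self_adjoint Q0).
have fp x : x != 0 -> 0 < f x x.
  move=> x0; rewrite lt_def Q0 andbT /f -SQ bopME adjointP Ss -normr_inner.
  rewrite sqrf_eq0 normr_eq0; apply: contra_neq x0 => Sx0.
  by rewrite -[x]bop1E -S'S bopME Sx0 bop_linear0.
pose m1 := bilinear_isBilinear.Build R[i] H H R[i] _ _ f fl.
pose m2 := isHermitianSesquilinear.Build R[i] H false Num.conj f fh.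
pose m3 := isDotProduct.Build R[i] H f fp.
pose B : {dot H for Num.conj} := HB.pack f m1 m2 m3.
by exists B.
Qed.

Lemma induced_norm_weighted Q : positive Q -> invertible Q ->
  forall B : {dot H for Num.conj}, (forall x y, B x y = inner (Q x) y) ->
  exists2 S, invertible S & forall x, induced_norm B x = hnorm (S x).
Proof.
move=> Q0 Qi B BE; have [S [Ss Si SQ]] := positive_square_root Q0 Qi.
exists S => // x; rewrite /induced_norm BE -SQ bopME adjointP Ss.
by rewrite -hnormX /= sqrtr_sqr ger0_norm ?hnorm_ge0.
Qed.

Lemma invertible_is_norm S : invertible S -> is_norm (fun x => hnorm (S x)).
Proof.
move=> [S' [_ S'S]]; split.
- move=> x Sx; have {}Sx : S x = 0 by apply: hnorm_le0; rewrite Sx.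
  by rewrite -[x]bop1E -S'S bopME Sx bop_linear0.
- move=> k x; apply: (@complexI R); rewrite rmorphM /= bop_linearZ -!hnormE.
  by rewrite normrZ (RRe_real (normr_real k)).
- by move=> x y; rewrite bop_linearD hnorm_triangle.
Qed.

Lemma invertible_equivalent_norm S :
  invertible S -> equivalent_norm (fun x => hnorm (S x)).
Proof.
move=> [S' [_ S'S]].
have [K K0 SK] := bop_le_norm_exists S.
have [C C0 SC] := bop_le_norm_exists S'.
exists C^-1, K; split => // [|x]; first by rewrite invr_gt0.
rewrite SK andbT mulrC ler_pdivrMr// mulrC.
by have := SC (S x); rewrite -bopME S'S.
Qed.

Lemma equivalent_norm_isometric_power_bounded (N : H -> R) T :
  equivalent_norm N -> (forall x, N (T x) = N x) -> power_bounded T.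
Proof.
move=> [c [C [c0 C0 NE]]] NT; apply/power_boundedP.
exists (C / c) => [|n x]; first by rewrite divr_gt0.
have NTn : N ((T ^+ n) x) = N x.
  by elim: n => [|n IH] //; rewrite exprS bopME NT.
have /andP[h1 _] := NE ((T ^+ n) x); have /andP[_ h2] := NE x.
rewrite mulrAC ler_pdivlMr// mulrC; apply: le_trans h1 _.
by rewrite NTn.
Qed.

End Invariant.

(** * Characterizations of power boundedness for expansive operators *)

Theorem theorem3p3 (R : realType) (H : hilbertType R)
    (Hinf : ~ finite_dimensional H) (m : nat) (hm : (1 <= m)%N)
    (P : bop H) (Ppos : positive P) (Pinv : invertible P)
    (T : bop H) (Texp : expansive m P T) :
  [<->
    power_bounded T;
    C1dot T /\ similar_to_isometry T;
    exists Q : bop H, [/\ positive Q, invertible Q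
      & forall n : nat, (1 <= n)%N -> op_isometric n Q T];
    exists (Q : bop H) (B : {dot H for Num.conj}),
      [/\ positive Q, invertible Q, forall x y, B x y = inner (Q x) y
        & [/\ is_norm (induced_norm B), equivalent_norm (induced_norm B)
        & forall n : nat, (1 <= n)%N -> norm_isometric n (induced_norm B) T]]
  ].
Proof.
tfae.
- move=> Tpb.
  have [Q [Q0 Qi TQ]] :=
    power_bounded_expansive_invariant hm Ppos Pinv Texp Tpb.
  exact: invariant_C1dot_similar TQ.
- move=> [_ /similar_to_isometry_invariant[Q [Q0 Qi TQ]]].
  by exists Q; split => // n n1; exact: op_isometric_invariant.
- move=> [Q [Q0 Qi QT]]; have [B BE] := weighted_dot Q0 Qi.
  exists Q, B; split => //.
  have [S Si] := induced_norm_weighted Q0 Qi BE.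
  have NQ x : induced_norm B x ^+ 2 = qform Q x.
    rewrite /induced_norm BE sqr_sqrtr //; exact: qform_ge0.
  move=> NE; split.
  + rewrite (_ : induced_norm B = (fun x => hnorm (S x))); last exact/funext.
    exact: invertible_is_norm.
  + rewrite (_ : induced_norm B = (fun x => hnorm (S x))); last exact/funext.
    exact: invertible_equivalent_norm.
  + move=> n n1 x; under eq_bigr do rewrite NQ.
    by rewrite -qform_defect QT// qform0.
- move=> [Q [B [Q0 Qi BE [_ Neq NT]]]].
  apply: equivalent_norm_isometric_power_bounded Neq _ => x.
  have := NT 1%N isT x; rewrite !big_ord_recl big_ord0 /=.
  rewrite !(expr0, expr1) bin0 bin1 !mulr1n !mulr1 !mul1r addr0 mulN1r => /eqP.
  by rewrite subr_eq0 eqrXn2 ?sqrtr_ge0// => /eqP ->.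
Qed.
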